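(* Let $0<z_c<z_0<1$ with $z_c<1-z_0$, let $k_0>k_1>0$, and let $\gamma_0,\gamma_1,\hat t_c,t^*$ be the shock curves and times defined in the context for the solution of the initial boundary value problem with piecewise constant shear rate ($a=k_0$ on $(0,z_c)$, $a=k_1$ on $(z_c,1)$) and flux $f(\varphi)=\varphi(\varphi-1)$. Then the lower shock $z=\gamma_0(t)$ reaches the interface $z=z_c$ at the time $$\hat t_c=\frac{1}{k_1}\left(\sqrt{z_0}+\sqrt{z_c}\right)^2,$$ and the two shocks $z=\gamma_0(t)$ and $z=\gamma_1(t)$ meet at the location $z=1-z_0$ at the time $$t^*=\frac{1}{k_1}\left(1+2\sqrt{z_0(1-z_0)}\right).$$ In particular, both $\hat t_c$ and the time to full segregation $t^*$ are independent of $k_0$.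
   Context: Consider the conservation law $\varphi_t+(a(z)f(\varphi))_z=0$ for $0<z<1$, $t>0$, with $f(\varphi)=\varphi(\varphi-1)$, $a(z)=k_0$ for $0<z<z_c$, $a(z)=k_1$ for $z_c<z<1$, initial data $\varphi(z,0)=0$ for $0<z<z_0$ and $\varphi(z,0)=1$ for $z_0<z<1$, and boundary conditions $\varphi(0,t)=1$, $\varphi(1,t)=0$. Its solution is built from the following pieces. (1) Rarefaction wave in $z_c<z<1$: $\varphi_1(z,t)=\frac12\left(\frac{z-z_0}{k_1t}+1\right)$. (2) Upper reflected shock: with $t_1=(1-z_0)/k_1$, $\gamma_1$ solves $\gamma_1'(t)=k_1(\varphi_1(\gamma_1(t),t)-1)$ for $t>t_1$, $\gamma_1(t_1)=1$ (with $\varphi=0$ above the shock). (3) Simple wave in $0<z<z_c$: put $t_c=(z_0-z_c)/k_1$ and, for $\tau\ge t_c$, $\varphi_+(\tau)=\varphi_1(z_c,\tau)=\frac12\left(1-\frac{t_c}{\tau}\right)$; let $\varphi_-(\tau)\in[0,\frac12)$ be the solution of the flux balance $k_0\varphi_-(\varphi_--1)=k_1\varphi_+(\varphi_+-1)$, with $\varphi_+=\varphi_+(\tau)$. The simple wave function $\Phi$ takes the constant value $\Phi(z,t)=\varphi_-(\tau)$ along each straight characteristic $z=k_0(2\varphi_-(\tau)-1)(t-\tau)+z_c$, $t>\tau$, $\tau\ge t_c$. (4) Lower reflected shock: with $t_0=t_c+z_c/k_0$, $\gamma_0$ solves $\gamma_0'(t)=k_0\Phi(\gamma_0(t),t)$,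 $\gamma_0(t_0)=0$, until the first time $\hat t_c$ at which $\gamma_0(\hat t_c)=z_c$ (with $\varphi=1$ below the shock). For $t>\hat t_c$ it is continued by $\gamma_0'(t)=k_1\varphi_1(\gamma_0(t),t)$, $\gamma_0(\hat t_c)=z_c$. (5) $t^*$ is the first time at which $\gamma_0(t^* )=\gamma_1(t^* )$. *)

(* Defs.v *)
From Stdlib Require Import Reals.
From Coquelicot Require Import Coquelicot.
Open Scope R_scope.

Definition flux (p : R) : R := p * (p - 1).

(* The rarefaction wave issuing from z0 in the part zc < z < 1 of the domain. *)
Definition phi1 (k1 z0 z t : R) : R := / 2 * ((z - z0) / (k1 * t) + 1).

Definition t1 (k1 z0 : R) : R := (1 - z0) / k1.
Definition tc (k1 zc z0 : R) : R := (z0 - zc) / k1.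
Definition t0 (k0 k1 zc z0 : R) : R := tc k1 zc z0 + zc / k0.

(* [phip tau] is the trace of the rarefaction wave at the upper side of the
   interface; it equals (1 - tc / tau) / 2. *)
Definition phip (k1 zc z0 tau : R) : R := phi1 k1 z0 zc tau.

(* [phim tau] is the trace at the lower side of the interface. *)
Definition is_lower_trace (k0 k1 zc z0 : R) (phim : R -> R) : Prop :=
  forall tau : R, tc k1 zc z0 <= tau ->
    0 <= phim tau < / 2 /\ k0 * flux (phim tau) = k1 * flux (phip k1 zc z0 tau).

(* (z, t) lies on the characteristic that leaves the interface at time tau. *)
Definition on_characteristic (k0 k1 zc z0 : R) (phim : R -> R) (tau z t : R)
    : Prop :=
  tc k1 zc z0 <= tau /\ tau < t /\ z = k0 * (2 * phim tau - 1) * (t - tau) + zc.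

Definition is_simple_wave (k0 k1 zc z0 : R) (phim : R -> R)
    (Phi : R -> R -> R) : Prop :=
  forall tau z t : R,
    on_characteristic k0 k1 zc z0 phim tau z t -> Phi z t = phim tau.

(* The domain of definition of the simple wave.  [Phi] is a total function, and
   [is_simple_wave] says nothing about its values elsewhere. *)
Definition in_simple_wave (k0 k1 zc z0 : R) (phim : R -> R) (z t : R) : Prop :=
  exists tau : R, on_characteristic k0 k1 zc z0 phim tau z t.

(* [t] is the first time, counted from [a] on, at which [P] holds. *)
Definition first_time (a : R) (P : R -> Prop) (t : R) : Prop :=
  a <= t /\ P t /\ (forall s : R, a <= s < t -> ~ P s).

Definition is_upper_shock (k1 z0 : R) (g1 : R -> R) : Prop :=
  g1 (t1 k1 z0) = 1 /\
  continuous_on (fun t => t1 k1 z0 <= t) g1 /\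
  (forall t : R, t1 k1 z0 < t -> is_derive g1 t (k1 * (phi1 k1 z0 (g1 t) t - 1))).

Definition interface_time (k0 k1 zc z0 : R) (g0 : R -> R) (t : R) : Prop :=
  first_time (t0 k0 k1 zc z0) (fun s => g0 s = zc) t.

(* It is not assumed that the lower shock ever reaches the interface: the first
   differential equation holds at every time before which (and at which) the
   curve has not met zc, and the second one after the first meeting, if any. *)
Definition is_lower_shock (k0 k1 zc z0 : R) (phim : R -> R) (Phi : R -> R -> R)
    (g0 : R -> R) : Prop :=
  g0 (t0 k0 k1 zc z0) = 0 /\
  continuous_on (fun t => t0 k0 k1 zc z0 <= t) g0 /\
  (forall t : R, t0 k0 k1 zc z0 < t ->
     (forall s : R, t0 k0 k1 zc z0 <= s <= t -> g0 s <> zc) ->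
     in_simple_wave k0 k1 zc z0 phim (g0 t) t /\
     is_derive g0 t (k0 * Phi (g0 t) t)) /\
  (forall that : R, interface_time k0 k1 zc z0 g0 that ->
     forall t : R, that < t -> is_derive g0 t (k1 * phi1 k1 z0 (g0 t) t)).

(* The meeting time is counted from the time on which both curves exist. *)
Definition meeting_time (k0 k1 zc z0 : R) (g0 g1 : R -> R) (t : R) : Prop :=
  first_time (Rmax (t0 k0 k1 zc z0) (t1 k1 z0)) (fun s => g0 s = g1 s) t.

Definition shock_curves (k0 k1 zc z0 : R) (g0 g1 : R -> R) : Prop :=
  is_upper_shock k1 z0 g1 /\
  exists (phim : R -> R) (Phi : R -> R -> R),
    is_lower_trace k0 k1 zc z0 phim /\
    is_simple_wave k0 k1 zc z0 phim Phi /\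
    is_lower_shock k0 k1 zc z0 phim Phi g0.

(* Main.v *)
Require Import Defs.
From Stdlib Require Import Reals Lra Ranalysis5 ClassicalEpsilon.
From Coquelicot Require Import Coquelicot.
Open Scope R_scope.

(** Each shock curve solves a differential equation whose solution can be
    written down, so everything follows from explicit formulas together with
    uniqueness of solutions.

    Against the rarefaction wave both shock equations are linear in the unknown
    curve.  In the variable [x = sqrt (k1 * t)] the upper shock is
    [1 - (x - sqrt (1 - z0))^2], and the lower shock above the interface is
    [(x - sqrt z0)^2], the constant of integration being fixed by [g0 = zc] at
    [x = sqrt z0 + sqrt zc].  These two parabolas meet where
    [x = sqrt z0 + sqrt (1 - z0)], at height [1 - z0]; squaring [x] gives the
    final time.

    The remaining point is the lower shock inside the simple wave, where [k0]
    enters.  Write [c] for [tc], [r = k1 / k0] and [1 - 2 * phim tau = p], so that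
    [p^2 = 1 - r (1 - (c / tau)^2)] by the flux balance.  Parametrize the shock by
    the time [tau] at which the characteristic it meets left the interface, and
    let [u = t - tau]; the shock is at [zc - k0 p u].  The shock equation becomes
    [((1 + p)^2 u)' = p^2 - 1], where the prime is the derivative in [tau].  As
    [p^2 - 1] is explicit, [(1 + p)^2 u = 4 zc / k0 - r (tau - c)^2 / tau]
    ([lag]).  The shock is at the interface exactly when [u = 0], that is when
    [k1 (tau - c)^2 = 4 zc tau]: here [k0] has cancelled, and the root above [c] is the
    claimed exit time
    ([exit_time_balance]).

    The map from [tau] to [t = tau + u] is strictly increasing, and inverting it
    yields an actual shock curve ([shock_in_simple_wave]).  It is the only one
    because the simple wave is Lipschitz in space ([simple_wave_lipschitz]):
    characteristics that leave the interface later are slower, so they never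
    converge, and [ode_unique] applies. *)

(** * Continuity, uniqueness for differential equations, inverse functions *)

Lemma lipschitz_continuous (f : R -> R) (L x : R) :
  (forall y z, Rabs (f y - f z) <= L * Rabs (y - z)) -> continuous f x.
Proof.
  intros hf.
  apply continuity_pt_filterlim.
  assert (hL : 0 <= L).
  { generalize (hf 1 0) (Rabs_pos (f 1 - f 0)).
    rewrite (Rabs_right (1 - 0)); lra. }
  intros eps heps; exists (eps / (L + 1)); split.
  { apply Rdiv_lt_0_compat; lra. }
  intros y [_ hy]; simpl in *; unfold R_dist in *.
  apply Rle_lt_trans with (1 := hf y x).
  apply Rmult_lt_compat_r with (r := L + 1) in hy; [|lra].
  replace (eps / (L + 1) * (L + 1)) with eps in hy by (field; lra).
  generalize (Rabs_pos (y - x)); nra.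
Qed.

Lemma continuous_Rmax (a x : R) : continuous (Rmax a) x.
Proof.
  apply (lipschitz_continuous _ 1); intros y z.
  unfold Rmax; repeat destruct Rle_dec; unfold Rabs; repeat destruct Rcase_abs; lra.
Qed.

Lemma continuous_Rmin (a x : R) : continuous (Rmin a) x.
Proof.
  apply (lipschitz_continuous _ 1); intros y z.
  unfold Rmin; repeat destruct Rle_dec; unfold Rabs; repeat destruct Rcase_abs; lra.
Qed.

(** The shock curves are continuous only from the right at their initial time;
    freezing the argument there turns this into continuity on the whole line,
    which the mean value theorem and neighbourhood arguments can use. *)
Lemma continuous_on_clamp (g : R -> R) (a : R) :
  continuous_on (fun t => a <= t) g ->
  forall t, continuous (fun s => g (Rmax a s)) t.
Proof.
  intros hg t.
  apply (filterlim_comp _ _ _ (Rmax a) g _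
           (within (fun s => a <= s) (locally (Rmax a t)))).
  - intros P hP.
    assert (h := continuous_Rmax a t _ hP); unfold filtermap in *.
    revert h; apply filter_imp.
    intros x hx; exact (hx (Rmax_l a x)).
  - apply hg, Rmax_l.
Qed.

Lemma locally_gt (a t : R) : a < t -> locally t (fun s => a < s).
Proof. intros h; apply (open_gt a); exact h. Qed.

Lemma locally_lt (b t : R) : t < b -> locally t (fun s => s < b).
Proof. intros h; apply (open_lt b); exact h. Qed.

(** Gronwall: [(f - g)^2 exp (- 2 K t)] is nonnegative, vanishes at [a], and is
    nonincreasing.  The equations are assumed on the open interval only, which is
    where the shock equations hold. *)
Lemma ode_unique (f g df dg : R -> R) (a b K : R) :
  continuous_on (fun t => a <= t) f -> continuous_on (fun t => a <= t) g ->
  f a = g a ->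
  (forall t, a < t < b -> is_derive f t (df t)) ->
  (forall t, a < t < b -> is_derive g t (dg t)) ->
  (forall t, a < t < b -> Rabs (df t - dg t) <= K * Rabs (f t - g t)) ->
  forall t, a <= t <= b -> f t = g t.
Proof.
  intros cf cg h0 hf hg hK t [hat htb].
  destruct (Req_dec a t) as [<- | hne]; [exact h0|].
  assert (hlt : a < t) by lra; clear hat hne.
  set (h := fun s => (f (Rmax a s) - g (Rmax a s)) ^ 2 * exp (- (2 * K) * s)).
  set (e := fun s => 2 * ((f s - g s) * (df s - dg s) - K * (f s - g s) ^ 2)
                     * exp (- (2 * K) * s)).
  assert (he : forall s, a < s < t -> e s <= 0).
  { intros s hs; assert (hk := hK s ltac:(lra)).
    unfold e; assert (hexp := exp_pos (- (2 * K) * s)).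
    assert ((f s - g s) * (df s - dg s) <= K * (f s - g s) ^ 2); [|nra].
    apply Rle_trans with (1 := Rle_abs _); rewrite Rabs_mult.
    rewrite <- (pow2_abs (f s - g s)).
    assert (hp := Rabs_pos (f s - g s)); nra. }
  (* The mean value theorem may return an endpoint, where the equations say
     nothing: truncating the derivative at 0 makes its sign unconditional. *)
  destruct (MVT_gen h a t (fun s => Rmin 0 (e s))) as [x [_ hx]].
  - intros s hs; rewrite Rmin_left, Rmax_right in hs by lra.
    rewrite Rmin_right by (apply he, hs).
    apply is_derive_ext_loc
      with (fun s => (f s - g s) ^ 2 * exp (- (2 * K) * s)).
    { apply filter_imp with (2 := locally_gt a s (proj1 hs)).
      intros y hy; unfold h; rewrite Rmax_right; lra. }
    assert (df1 := hf s ltac:(lra)); assert (dg1 := hg s ltac:(lra)).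
    assert (ex_derive f s) by (eexists; exact df1).
    assert (ex_derive g s) by (eexists; exact dg1).
    auto_derive; [auto|].
    replace (Derive (fun x => f x) s) with (df s)
      by (symmetry; apply is_derive_unique, df1).
    replace (Derive (fun x => g x) s) with (dg s)
      by (symmetry; apply is_derive_unique, dg1).
    unfold e; ring.
  - intros s _; apply continuity_pt_filterlim.
    assert (cd : continuous (fun u => f (Rmax a u) - g (Rmax a u)) s).
    { apply (continuous_minus (V := R_NormedModule));
        apply continuous_on_clamp; assumption. }
    apply (continuous_mult (K := R_AbsRing)
             (fun u => (f (Rmax a u) - g (Rmax a u)) ^ 2)).
    + apply (continuous_comp _ (fun y => y ^ 2) _ cd).
      apply (ex_derive_continuous (V := R_NormedModule)); auto_derive; auto.
    + apply (ex_derive_continuous (V := R_NormedModule)); auto_derive; auto.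
  - assert (hmin := Rmin_l 0 (e x)); assert (hexp := exp_pos (- (2 * K) * t)).
    unfold h in hx; rewrite (Rmax_left a a), (Rmax_right a t), h0 in hx by lra.
    assert (hsq : (f t - g t) ^ 2 <= 0) by nra.
    nra.
Qed.

(** Since [f] grows at rate at least [m], its inverse is Lipschitz with constant
    [1 / m]; clamping the argument between [f a] and [f b] makes the inverse continuous on
    the whole line, so that later constructions need no one-sided limits. *)
Lemma inverse_function (f df : R -> R) (a b m : R) :
  a < b -> 0 < m ->
  (forall x, a <= x <= b -> is_derive f x (df x)) ->
  (forall x, a <= x <= b -> m <= df x) ->
  exists s : R -> R,
    (forall y, a <= s y <= b) /\
    (forall x, a <= x <= b -> s (f x) = x) /\
    (forall y, f a <= y <= f b -> f (s y) = y) /\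
    (forall y, continuous s y) /\
    (forall y, f a < y < f b -> is_derive s y (/ df (s y))).
Proof.
  intros hab hm hf hdf.
  assert (grow : forall x y, a <= x -> x <= y -> y <= b ->
                   m * (y - x) <= f y - f x).
  { intros x y hx hxy hy.
    destruct (MVT_gen f x y df) as [c [hc heq]];
      try (intros c; rewrite Rmin_left, Rmax_right by lra; intros hc).
    - apply hf; lra.
    - apply continuity_pt_filterlim, (ex_derive_continuous (V := R_NormedModule)).
      exists (df c); apply hf; lra.
    - rewrite Rmin_left, Rmax_right in hc by lra.
      rewrite heq; apply Rmult_le_compat_r; [lra|]; apply hdf; lra. }
  assert (hfab : f a < f b) by (generalize (grow a b); nra).
  set (cl := fun y => Rmax (f a) (Rmin (f b) y)).
  assert (hcl : forall y, f a <= cl y <= f b).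
  { intros y; unfold cl; split; [apply Rmax_l|].
    apply Rmax_lub; [lra | apply Rmin_l]. }
  assert (hcl' : forall y, f a <= y <= f b -> cl y = y).
  { intros y hy; unfold cl; rewrite Rmin_right, Rmax_right; lra. }
  assert (hinv : forall y, {x | a <= x <= b /\ f x = cl y}).
  { intros y; apply constructive_indefinite_description.
    destruct (f_interv_is_interv f a b (cl y)) as [x hx];
      [lra | apply hcl | | exists x; exact hx].
    intros x hx.
    apply continuity_pt_filterlim, (ex_derive_continuous (V := R_NormedModule)).
    exists (df x); apply hf; lra. }
  set (s := fun y => proj1_sig (hinv y)).
  assert (hs : forall y, a <= s y <= b /\ f (s y) = cl y)
    by (intros y; exact (proj2_sig (hinv y))).
  assert (hlip : forall y z, m * Rabs (s y - s z) <= Rabs (cl y - cl z)).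
  { intros y z; destruct (hs y) as [hy ey], (hs z) as [hz ez].
    rewrite <- ey, <- ez.
    destruct (Rle_dec (s y) (s z)) as [h|h].
    - assert (hg := grow (s y) (s z) ltac:(lra) h ltac:(lra)).
      rewrite !Rabs_left1; nra.
    - assert (hg := grow (s z) (s y) ltac:(lra) ltac:(lra) ltac:(lra)).
      rewrite !Rabs_right; nra. }
  assert (hc : forall y, continuous s y).
  { intros y; apply (lipschitz_continuous _ (/ m)); intros u v.
    apply Rmult_le_reg_l with m; [exact hm|].
    apply Rle_trans with (1 := hlip u v).
    replace (m * (/ m * Rabs (u - v))) with (Rabs (u - v)) by (field; lra).
    unfold cl, Rmax, Rmin; repeat destruct Rle_dec;
      unfold Rabs; repeat destruct Rcase_abs; lra. }
  exists s; split; [exact (fun y => proj1 (hs y))|]; split; [|split; [|split; [exact hc|]]].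
  - intros x hx; destruct (hs (f x)) as [hy ey].
    assert (g1 := grow a x ltac:(lra) ltac:(lra) ltac:(lra)).
    assert (g2 := grow x b ltac:(lra) ltac:(lra) ltac:(lra)).
    rewrite hcl' in ey by nra.
    destruct (Rtotal_order (s (f x)) x) as [h | [h | h]]; [| exact h |].
    + assert (g3 := grow (s (f x)) x ltac:(lra) ltac:(lra) ltac:(lra)); nra.
    + assert (g3 := grow x (s (f x)) ltac:(lra) ltac:(lra) ltac:(lra)); nra.
  - intros y hy; rewrite (proj2 (hs y)); apply hcl', hy.
  - intros y hy.
    assert (Prf : forall x, s (f a) <= x <= s (f b) -> derivable_pt f x).
    { intros x hx; exists (df x); apply is_derive_Reals, hf.
      destruct (hs (f a)), (hs (f b)); lra. }
    assert (mono : forall u v, f a <= u -> u <= v -> v <= f b -> s u <= s v).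
    { intros u v hu huv hv; destruct (hs u) as [au eu], (hs v) as [av ev].
      rewrite hcl' in eu by lra; rewrite hcl' in ev by lra.
      destruct (Rle_dec (s u) (s v)) as [|h]; [assumption|exfalso].
      assert (hg := grow (s v) (s u) ltac:(lra) ltac:(lra) ltac:(lra)); nra. }
    assert (hin : s (f a) <= s y <= s (f b)) by (split; apply mono; lra).
    assert (hd : derive_pt f (s y) (Prf (s y) hin) = df (s y)).
    { apply derive_pt_eq_0, is_derive_Reals, hf, hs. }
    assert (hpos : 0 < df (s y)).
    { apply Rlt_le_trans with (1 := hm); apply hdf, hs. }
    apply is_derive_Reals.
    rewrite <- hd, <- Rdiv_1_l.
    apply (derivable_pt_lim_recip_interv f s (f a) (f b)); try assumption.
    + apply continuity_pt_filterlim, hc.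
    + intros x hx; unfold comp, id; rewrite (proj2 (hs x)); apply hcl', hx.
    + rewrite hd; lra.
Qed.

(** The first hit is the supremum of the times before which there is none: if
    [g] differed from [c] there, it would do so slightly later as well. *)
Lemma first_hit (g : R -> R) (a b c : R) :
  continuous_on (fun t => a <= t) g -> a <= b -> g b = c ->
  exists t, t <= b /\ first_time a (fun s => g s = c) t.
Proof.
  intros hg hab hb.
  set (E := fun x => a <= x <= b /\ forall s, a <= s < x -> g s <> c).
  destruct (completeness E) as [t [hub hlub]].
  - exists b; intros x [hx _]; lra.
  - exists a; split; [lra|]; intros s hs; lra.
  - assert (hat : a <= t).
    { apply hub; split; [lra|]; intros s hs; lra. }
    assert (htb : t <= b) by (apply hlub; intros x [hx _]; lra).
    assert (hbefore : forall s, a <= s < t -> g s <> c).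
    { intros s hs hsc.
      assert (t <= s); [|lra].
      apply hlub; intros x [hx hx']; apply Rnot_lt_le; intros hsx.
      apply (hx' s); [lra | exact hsc]. }
    exists t; split; [exact htb|]; split; [exact hat|]; split; [|exact hbefore].
    destruct (Req_dec (g t) c) as [|hne]; [assumption|exfalso].
    assert (hlt : t < b).
    { destruct (Req_dec t b) as [e|e]; [|lra].
      elim hne; rewrite e; exact hb. }
    assert (hloc : locally t (fun s => g (Rmax a s) <> c)).
    { apply (continuous_on_clamp g a hg t (fun y => y <> c)).
      rewrite Rmax_right by lra; apply open_neq, hne. }
    destruct hloc as [d hd].
    assert (hd0 := cond_pos d).
    set (x := Rmin b (t + d / 2)).
    assert (hx : t < x <= b /\ x <= t + d / 2)
      by (unfold x, Rmin; destruct Rle_dec; lra).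
    assert (x <= t); [|lra].
    apply hub; split; [lra|]; intros s hs.
    destruct (Rlt_dec s t) as [h|h]; [apply hbefore; lra|].
    rewrite <- (Rmax_right a s) by lra; apply hd.
    unfold ball; simpl; unfold AbsRing_ball, abs, minus, plus, opp; simpl.
    rewrite Rabs_right; lra.
Qed.

Lemma first_time_unique (a : R) (P : R -> Prop) (s t : R) :
  first_time a P s -> first_time a P t -> s = t.
Proof.
  intros (hs & ps & ns) (ht & pt & nt).
  destruct (Rtotal_order s t) as [h | [h | h]]; [| exact h |]; exfalso.
  - apply (nt s); [lra | exact ps].
  - apply (ns t); [lra | exact pt].
Qed.

(** * Interface trace and simple wave *)

(** The speed of the characteristic that leaves the interface at time [tau], in
    units of [k0] and directed downwards: [1 - 2 * phim tau], with [r = k1 / k0]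
    and [c = tc]. *)
Definition speed (r c tau : R) : R := sqrt (1 - r * (1 - (c / tau) ^ 2)).

(** The smaller root of the flux balance at the interface. *)
Definition trace (r c tau : R) : R := (1 - speed r c tau) / 2.

Lemma ratio_sq_bounds (c tau : R) : 0 < c -> c <= tau -> 0 < (c / tau) ^ 2 <= 1.
Proof.
  intros hc h.
  assert (0 < c / tau <= 1); [|nra].
  split; [apply Rdiv_lt_0_compat; lra|].
  apply Rmult_le_reg_r with tau; [lra|].
  unfold Rdiv; rewrite Rmult_assoc, Rinv_l; lra.
Qed.

Lemma speed_sq (r c tau : R) : 0 < r < 1 -> 0 < c -> c <= tau ->
  speed r c tau ^ 2 = 1 - r * (1 - (c / tau) ^ 2).
Proof.
  intros hr hc h; unfold speed; apply pow2_sqrt.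
  assert (hq := ratio_sq_bounds c tau hc h); nra.
Qed.

Lemma speed_bounds (r c tau : R) : 0 < r < 1 -> 0 < c -> c <= tau ->
  sqrt (1 - r) <= speed r c tau <= 1.
Proof.
  intros hr hc h; assert (hq := ratio_sq_bounds c tau hc h); unfold speed; split.
  - apply sqrt_le_1_alt; nra.
  - apply Rle_trans with (sqrt 1); [|rewrite sqrt_1; lra]; apply sqrt_le_1_alt; nra.
Qed.

Lemma speed_initial (r c : R) : 0 < c -> speed r c c = 1.
Proof.
  intros hc; unfold speed.
  replace (1 - r * (1 - (c / c) ^ 2)) with 1 by (field; lra); apply sqrt_1.
Qed.

(** Divide the difference of the squares, which is explicit, by the sum of the
    speeds, which is at least [2 * sqrt (1 - r)]. *)
Lemma speed_variation (r c t1 t2 : R) : 0 < r < 1 -> 0 < c -> c <= t1 <= t2 ->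
  0 <= speed r c t1 - speed r c t2 <= / (c * sqrt (1 - r)) * (t2 - t1).
Proof.
  intros hr hc [h1 h2].
  assert (hm : 0 < sqrt (1 - r)) by (apply sqrt_lt_R0; lra).
  assert (b1 := speed_bounds r c t1 hr hc h1).
  assert (b2 := speed_bounds r c t2 hr hc ltac:(lra)).
  assert (s1 := speed_sq r c t1 hr hc h1).
  assert (s2 := speed_sq r c t2 hr hc ltac:(lra)).
  set (p := speed r c t1) in *; set (q := speed r c t2) in *; set (m := sqrt (1 - r)) in *.
  assert (i1 : 0 < / t1 <= / c).
  { split; [apply Rinv_0_lt_compat; lra | apply Rinv_le_contravar; lra]. }
  assert (i2 : 0 < / t2 <= / t1).
  { split; [apply Rinv_0_lt_compat; lra | apply Rinv_le_contravar; lra]. }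
  assert (hdiff : p ^ 2 - q ^ 2 = r * (c * / t1 + c * / t2) * (c * / t1 * / t2) * (t2 - t1)).
  { rewrite s1, s2; field; lra. }
  assert (u1 : 0 < c * / t1 <= 1).
  { replace 1 with (c * / c) by (field; lra); nra. }
  assert (u2 : 0 < c * / t2 <= 1) by nra.
  assert (hu : 0 <= r * (c * / t1 + c * / t2) * (c * / t1 * / t2) <= 2 * / c).
  { assert (0 < c * / t1 * / t2 <= / c) by (split; nra). 
    assert (0 <= r * (c * / t1 + c * / t2) <= 2) by (split; nra).
    split; nra. }
  split.
  - assert (0 <= p ^ 2 - q ^ 2) by (rewrite hdiff; nra). nra.
  - rewrite Rinv_mult.
    apply Rmult_le_reg_l with (2 * m); [lra|].
    replace (2 * m * (/ c * / m * (t2 - t1))) with (2 * / c * (t2 - t1)) by (field; lra).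
    apply Rle_trans with (p ^ 2 - q ^ 2); [|rewrite hdiff; nra].
    assert (0 <= p ^ 2 - q ^ 2) by (rewrite hdiff; nra).
    assert (0 <= p - q) by nra. nra.
Qed.

Lemma is_derive_speed (r c tau : R) : 0 < r < 1 -> 0 < c -> c <= tau ->
  is_derive (speed r c) tau (- (r * c ^ 2 / (tau ^ 3 * speed r c tau))).
Proof.
  intros hr hc h.
  assert (hq := ratio_sq_bounds c tau hc h).
  unfold speed; auto_derive.
  - repeat split; try lra; simpl in hq; nra.
  - assert (0 < sqrt (1 - r * (1 - (c / tau) ^ 2))) by (apply sqrt_lt_R0; nra).
    replace (1 + - (r * (1 + - (c * / tau * (c * / tau * 1)))))
      with (1 - r * (1 - (c / tau) ^ 2)) by (unfold Rdiv; ring).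
    field; lra.
Qed.

Lemma shear_ratio_bounds (k0 k1 : R) : 0 < k1 < k0 -> 0 < k1 / k0 < 1.
Proof.
  intros hk; split; [apply Rdiv_lt_0_compat; lra|].
  apply (Rmult_lt_reg_r k0); [lra|]; unfold Rdiv; rewrite Rmult_assoc, Rinv_l; lra.
Qed.

Lemma flux_rarefaction_trace (k1 zc z0 tau : R) : 0 < k1 -> 0 < tau ->
  flux (phip k1 zc z0 tau) = - / 4 * (1 - (tc k1 zc z0 / tau) ^ 2).
Proof. intros; unfold flux, phip, phi1, tc; field; lra. Qed.

Lemma trace_is_lower_trace (k0 k1 zc z0 : R) : 0 < k1 < k0 -> 0 < tc k1 zc z0 ->
  is_lower_trace k0 k1 zc z0 (trace (k1 / k0) (tc k1 zc z0)).
Proof.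
  intros hk hc tau h.
  assert (hr := shear_ratio_bounds k0 k1 hk).
  rewrite flux_rarefaction_trace by lra.
  assert (hb := speed_bounds _ _ tau hr hc h).
  assert (hs := speed_sq _ _ tau hr hc h).
  assert (hm : 0 < sqrt (1 - k1 / k0)) by (apply sqrt_lt_R0; lra).
  unfold trace, flux; split; [lra|].
  set (w := (tc k1 zc z0 / tau) ^ 2) in *; set (s := speed _ _ _) in *.
  replace (k0 * ((1 - s) / 2 * ((1 - s) / 2 - 1))) with (k0 * / 4 * (s ^ 2 - 1)) by field.
  rewrite hs; field; lra.
Qed.

(** The flux is symmetric about [1 / 2], hence injective below it. *)
Lemma lower_trace_unique (k0 k1 zc z0 : R) (phim phim' : R -> R) (tau : R) :
  0 < k0 -> is_lower_trace k0 k1 zc z0 phim -> is_lower_trace k0 k1 zc z0 phim' ->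
  tc k1 zc z0 <= tau -> phim tau = phim' tau.
Proof.
  intros hk h h' ht.
  destruct (h tau ht) as [b e], (h' tau ht) as [b' e'].
  rewrite <- e' in e; apply Rmult_eq_reg_l in e; [|lra].
  unfold flux in e.
  assert (f : (phim tau - phim' tau) * (phim tau + phim' tau - 1) = 0) by lra.
  apply Rmult_integral in f; lra.
Qed.

(** If [tau1 <= tau2], the later characteristic is slower and has travelled for a
    shorter time, so at time [t] the two are at least
    [k0 * m * (tau2 - tau1)] apart, while their values differ by at most a
    multiple of [tau2 - tau1].  For [z1 = z2] this shows that the simple wave is
    well defined. *)
Lemma simple_wave_lipschitz (k0 k1 zc z0 tau1 tau2 z1 z2 t : R) :
  let r := k1 / k0 in let c := tc k1 zc z0 in let m := sqrt (1 - r) in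
  0 < r < 1 -> 0 < c -> 0 < k0 ->
  on_characteristic k0 k1 zc z0 (trace r c) tau1 z1 t ->
  on_characteristic k0 k1 zc z0 (trace r c) tau2 z2 t ->
  k0 * Rabs (trace r c tau1 - trace r c tau2)
    <= / (2 * c * m ^ 2) * Rabs (z1 - z2).
Proof.
  intros r c m hr hc hk.
  assert (hm : 0 < m) by (apply sqrt_lt_R0; lra).
  assert (wlog : forall tau1 tau2 z1 z2, tau1 <= tau2 ->
    on_characteristic k0 k1 zc z0 (trace r c) tau1 z1 t ->
    on_characteristic k0 k1 zc z0 (trace r c) tau2 z2 t ->
    k0 * Rabs (trace r c tau1 - trace r c tau2)
      <= / (2 * c * m ^ 2) * Rabs (z1 - z2)).
  { clear tau1 tau2 z1 z2; intros tau1 tau2 z1 z2 hle (h1 & l1 & e1) (h2 & l2 & e2).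
    fold c in h1, h2.
    assert (hv := speed_variation r c tau1 tau2 hr hc ltac:(lra)).
    assert (hb := speed_bounds r c tau1 hr hc h1).
    unfold trace in *; set (p := speed r c tau1) in *; set (q := speed r c tau2) in *.
    fold m in hv, hb.
    assert (hz : k0 * m * (tau2 - tau1) <= z2 - z1).
    { rewrite e1, e2.
      replace (k0 * (2 * ((1 - q) / 2) - 1) * (t - tau2) + zc -
        (k0 * (2 * ((1 - p) / 2) - 1) * (t - tau1) + zc))
        with (k0 * (p * (tau2 - tau1) + (p - q) * (t - tau2))) by field.
      rewrite Rmult_assoc; apply Rmult_le_compat_l; [lra|].
      nra. }
    assert (0 <= z2 - z1).
    { apply Rle_trans with (2 := hz); assert (0 < k0 * m) by nra; nra. }
    replace ((1 - p) / 2 - (1 - q) / 2) with (- ((p - q) / 2)) by field.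
    rewrite Rabs_Ropp, Rabs_right, Rabs_left1 by lra.
    apply Rle_trans with (/ (2 * c * m ^ 2) * (k0 * m * (tau2 - tau1))).
    - replace (/ (2 * c * m ^ 2) * (k0 * m * (tau2 - tau1)))
        with (k0 * / 2 * (/ (c * m) * (tau2 - tau1))) by (field; lra).
      nra.
    - replace (- (z1 - z2)) with (z2 - z1) by ring.
      apply Rmult_le_compat_l; [|exact hz].
      apply Rlt_le, Rinv_0_lt_compat, Rmult_lt_0_compat; [lra | apply pow_lt, hm]. }
  intros c1 c2; destruct (Rle_dec tau1 tau2) as [h|h].
  - apply wlog; assumption.
  - rewrite (Rabs_minus_sym (trace _ _ _)), (Rabs_minus_sym z1); apply wlog; try assumption; lra.
Qed.

(** * Meeting of the lower shock with the characteristics *)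

(** The time the characteristic released at [tau] travels before the shock meets
    it, with [d = 4 * zc / k0]: the solution [u] of
    [((1 + p)^2 u)' = p^2 - 1], [p] being the speed, with [u = zc / k0] at
    [tau = c]. *)
Definition lag (r c d tau : R) : R :=
  (d - r * (tau - c) ^ 2 / tau) / (1 + speed r c tau) ^ 2.

Lemma lag_initial (r c d : R) : 0 < c -> lag r c d c = d / 4.
Proof. intros hc; unfold lag; rewrite speed_initial by assumption; field; lra. Qed.

Lemma lag_final (r c d b : R) : 0 < b -> r * (b - c) ^ 2 = d * b -> lag r c d b = 0.
Proof.
  intros hb e; unfold lag; rewrite e.
  replace (d - d * b / b) with 0 by (field; lra); unfold Rdiv; ring.
Qed.

(** The numerator of [lag] decreases in [tau] after [c] and vanishes at [b]. *)
Lemma lag_pos (r c d b tau : R) : 0 < r < 1 -> 0 < c -> c <= tau < b ->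
  r * (b - c) ^ 2 = d * b -> 0 < lag r c d tau.
Proof.
  intros hr hc h e.
  assert (hs := sqrt_pos (1 - r * (1 - (c / tau) ^ 2))); fold (speed r c tau) in hs.
  apply Rdiv_lt_0_compat; [|apply pow_lt; lra].
  replace (d - r * (tau - c) ^ 2 / tau)
    with (r * ((b - tau) * (b * tau - c ^ 2)) / (b * tau)).
  - apply Rdiv_lt_0_compat; [|nra].
    apply Rmult_lt_0_compat; [lra|]; apply Rmult_lt_0_compat; nra.
  - replace d with (r * (b - c) ^ 2 / b) by (rewrite e; field; lra).
    field; lra.
Qed.

(** The derivative of the time [tau + lag tau] of the encounter, put in the form in which
    it is visibly at least the speed when the lag is nonnegative; the terms
    without [lag] combine by [speed_sq]. *)
Definition arrival_rate (r c d tau : R) : R :=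
  2 * (speed r c tau + lag r c d tau * (r * c ^ 2 / (tau ^ 3 * speed r c tau)))
  / (1 + speed r c tau).

Lemma is_derive_arrival (r c d tau : R) : 0 < r < 1 -> 0 < c -> c <= tau ->
  is_derive (fun x => x + lag r c d x) tau (arrival_rate r c d tau).
Proof.
  intros hr hc h.
  assert (hd := is_derive_speed r c tau hr hc h).
  assert (hb := speed_bounds r c tau hr hc h).
  assert (hm : 0 < sqrt (1 - r)) by (apply sqrt_lt_R0; lra).
  assert (hs := speed_sq r c tau hr hc h).
  assert (he : ex_derive (speed r c) tau) by (eexists; exact hd).
  unfold lag, arrival_rate; auto_derive.
  - repeat split; try lra; try assumption.
    assert (0 < 1 + speed r c tau) by lra. nra.
  - replace (Derive (fun x => speed r c x) tau) with (- (r * c ^ 2 / (tau ^ 3 * speed r c tau)))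
      by (symmetry; apply is_derive_unique, hd).
    unfold lag; set (p := speed r c tau) in *.
    assert (hr' : r * c ^ 2 / tau ^ 2 = p ^ 2 - 1 + r).
    { rewrite hs; field; lra. }
    (* The two sides differ by a multiple of the equation for the square of the
       speed. *)
    match goal with |- ?a = ?b =>
      assert (hdiff : a - b = (p ^ 2 - 1 + r - r * c ^ 2 / tau ^ 2) * - / (1 + p) ^ 2)
    end.
    { field; lra. }
    rewrite hr' in hdiff; lra.
Qed.

(** * Explicit times and curves in the rarefaction wave *)

Definition exit_time (k1 zc z0 : R) : R := 1 / k1 * (sqrt z0 + sqrt zc) ^ 2.

Definition final_time (k1 z0 : R) : R := 1 / k1 * (1 + 2 * sqrt (z0 * (1 - z0))).

Definition upper_curve (k1 z0 t : R) : R := 1 - (sqrt (k1 * t) - sqrt (1 - z0)) ^ 2.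

Definition lower_curve (k1 z0 t : R) : R := (sqrt (k1 * t) - sqrt z0) ^ 2.

(** The lag vanishes when [r (tau - c)^2 = (4 zc / k0) tau].  Multiplying by [k0]
    removes it from the equation, so the exit time is independent of [k0]. *)
Lemma exit_time_balance (k1 zc z0 : R) : 0 < k1 -> 0 < zc -> zc < z0 ->
  k1 * (exit_time k1 zc z0 - tc k1 zc z0) ^ 2 = 4 * zc * exit_time k1 zc z0.
Proof.
  intros hk hzc hz; unfold exit_time, tc.
  assert (e0 := pow2_sqrt z0 ltac:(lra)); assert (ec := pow2_sqrt zc ltac:(lra)).
  rewrite <- e0 at 2; rewrite <- ec at 2 3.
  field; lra.
Qed.

Lemma exit_time_late (k0 k1 zc z0 : R) : 0 < k1 < k0 -> 0 < zc -> zc < z0 ->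
  tc k1 zc z0 < t0 k0 k1 zc z0 < exit_time k1 zc z0.
Proof.
  intros hk hzc hz; unfold t0; split.
  { assert (0 < zc / k0) by (apply Rdiv_lt_0_compat; lra); lra. }
  apply Rlt_trans with (z0 / k1).
  - assert (zc / k0 < zc / k1).
    { apply Rmult_lt_compat_l; [lra|]; apply Rinv_lt_contravar; nra. }
    unfold tc, Rdiv in *; lra.
  - unfold exit_time, Rdiv; rewrite Rmult_1_l, Rmult_comm.
    apply Rmult_lt_compat_l; [apply Rinv_0_lt_compat; lra|].
    assert (e0 := pow2_sqrt z0 ltac:(lra)).
    assert (hs := sqrt_lt_R0 z0 ltac:(lra)); assert (hsc := sqrt_lt_R0 zc ltac:(lra)); nra.
Qed.

Lemma sqrt_exit_time (k1 zc z0 : R) : 0 < k1 ->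
  sqrt (k1 * exit_time k1 zc z0) = sqrt z0 + sqrt zc.
Proof.
  intros hk; unfold exit_time.
  replace (k1 * (1 / k1 * (sqrt z0 + sqrt zc) ^ 2)) with ((sqrt z0 + sqrt zc) ^ 2)
    by (field; lra).
  apply sqrt_pow2; generalize (sqrt_pos z0) (sqrt_pos zc); lra.
Qed.

Lemma sqrt_final_time (k1 z0 : R) : 0 < k1 -> 0 < z0 < 1 ->
  sqrt (k1 * final_time k1 z0) = sqrt z0 + sqrt (1 - z0).
Proof.
  intros hk hz; unfold final_time.
  rewrite (sqrt_mult z0) by lra.
  replace (k1 * (1 / k1 * (1 + 2 * (sqrt z0 * sqrt (1 - z0)))))
    with ((sqrt z0 + sqrt (1 - z0)) ^ 2).
  - apply sqrt_pow2; generalize (sqrt_pos z0) (sqrt_pos (1 - z0)); lra.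
  - assert (e0 := pow2_sqrt z0 ltac:(lra)); assert (e1 := pow2_sqrt (1 - z0) ltac:(lra)).
    field_simplify; [|lra]; nra.
Qed.

Lemma lower_curve_exit (k1 zc z0 : R) : 0 < k1 -> 0 < zc ->
  lower_curve k1 z0 (exit_time k1 zc z0) = zc.
Proof.
  intros hk hz; unfold lower_curve; rewrite sqrt_exit_time by exact hk.
  replace (sqrt z0 + sqrt zc - sqrt z0) with (sqrt zc) by ring.
  apply pow2_sqrt; lra.
Qed.

Lemma upper_curve_initial (k1 z0 : R) : 0 < k1 -> upper_curve k1 z0 (t1 k1 z0) = 1.
Proof.
  intros hk; unfold upper_curve, t1.
  replace (k1 * ((1 - z0) / k1)) with (1 - z0) by (field; lra); ring.
Qed.

Lemma continuous_upper_curve (k1 z0 t : R) : continuous (upper_curve k1 z0) t.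
Proof.
  apply (continuous_comp (fun t => sqrt (k1 * t)) (fun x => 1 - (x - sqrt (1 - z0)) ^ 2)).
  - apply continuous_sqrt_comp.
    apply (ex_derive_continuous (V := R_NormedModule)); auto_derive; auto.
  - apply (ex_derive_continuous (V := R_NormedModule)); auto_derive; auto.
Qed.

Lemma continuous_lower_curve (k1 z0 t : R) : continuous (lower_curve k1 z0) t.
Proof.
  apply (continuous_comp (fun t => sqrt (k1 * t)) (fun x => (x - sqrt z0) ^ 2)).
  - apply continuous_sqrt_comp.
    apply (ex_derive_continuous (V := R_NormedModule)); auto_derive; auto.
  - apply (ex_derive_continuous (V := R_NormedModule)); auto_derive; auto.
Qed.

Lemma is_derive_upper_curve (k1 z0 t : R) : 0 < k1 -> z0 < 1 -> 0 < t ->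
  is_derive (upper_curve k1 z0) t (k1 * (phi1 k1 z0 (upper_curve k1 z0 t) t - 1)).
Proof.
  intros hk hz ht; unfold upper_curve, phi1.
  assert (hx : 0 < sqrt (k1 * t)) by (apply sqrt_lt_R0; nra).
  assert (ex := pow2_sqrt (k1 * t) ltac:(nra)).
  assert (e1 := pow2_sqrt (1 - z0) ltac:(lra)).
  auto_derive; [nra|].
  rewrite <- ex at 4.
  set (x := sqrt (k1 * t)) in *; set (y := sqrt (1 - z0)) in *.
  replace z0 with (1 - y ^ 2) by lra.
  field; lra.
Qed.

Lemma is_derive_lower_curve (k1 z0 t : R) : 0 < k1 -> 0 < z0 -> 0 < t ->
  is_derive (lower_curve k1 z0) t (k1 * phi1 k1 z0 (lower_curve k1 z0 t) t).
Proof.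
  intros hk hz ht; unfold lower_curve, phi1.
  assert (hx : 0 < sqrt (k1 * t)) by (apply sqrt_lt_R0; nra).
  assert (ex := pow2_sqrt (k1 * t) ltac:(nra)).
  assert (e1 := pow2_sqrt z0 ltac:(lra)).
  auto_derive; [nra|].
  rewrite <- ex at 4.
  set (x := sqrt (k1 * t)) in *; set (y := sqrt z0) in *.
  replace z0 with (y ^ 2) by lra.
  field; lra.
Qed.

(** The equation is linear with coefficient [1 / (2 t)], bounded by [1 / (2 a)].
    The shift [l] is [1] for the upper shock and [0] for the lower one. *)
Lemma rarefaction_ode_unique (k1 z0 l a : R) (f g : R -> R) :
  0 < k1 -> 0 < a ->
  continuous_on (fun t => a <= t) f -> continuous_on (fun t => a <= t) g ->
  f a = g a ->
  (forall t, a < t -> is_derive f t (k1 * (phi1 k1 z0 (f t) t - l))) ->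
  (forall t, a < t -> is_derive g t (k1 * (phi1 k1 z0 (g t) t - l))) ->
  forall t, a <= t -> f t = g t.
Proof.
  intros hk ha cf cg h0 hf hg t ht.
  apply (ode_unique f g _ _ a t (/ (2 * a)) cf cg h0 (fun s hs => hf s (proj1 hs))
           (fun s hs => hg s (proj1 hs))); [|lra].
  intros s [hs _]; unfold phi1.
  match goal with |- Rabs ?x <= _ => replace x with (/ (2 * s) * (f s - g s)) by (field; lra) end.
  rewrite Rabs_mult; apply Rmult_le_compat_r; [apply Rabs_pos|].
  rewrite Rabs_right.
  - apply Rinv_le_contravar; lra.
  - apply Rle_ge, Rlt_le, Rinv_0_lt_compat; lra.
Qed.

Lemma upper_shock_exists (k1 z0 : R) : 0 < k1 -> z0 < 1 ->
  is_upper_shock k1 z0 (upper_curve k1 z0).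
Proof.
  intros hk hz; split; [|split].
  - apply upper_curve_initial, hk.
  - apply continuous_on_forall; intros t _; apply continuous_upper_curve.
  - intros t ht; apply is_derive_upper_curve; try assumption.
    apply Rlt_trans with (2 := ht); apply Rdiv_lt_0_compat; lra.
Qed.

Lemma upper_shock_unique (k1 z0 : R) (g : R -> R) : 0 < k1 -> z0 < 1 ->
  is_upper_shock k1 z0 g -> forall t, t1 k1 z0 <= t -> g t = upper_curve k1 z0 t.
Proof.
  intros hk hz (h1 & c1 & d1).
  destruct (upper_shock_exists k1 z0 hk hz) as (h2 & c2 & d2).
  apply (rarefaction_ode_unique k1 z0 1); try assumption.
  - apply Rdiv_lt_0_compat; lra.
  - rewrite h1, h2; reflexivity.
Qed.

(** * Lower shock *)

(** Follow the characteristics: with [s t] the release time of the characteristic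
    met at time [t], obtained by inverting [tau + lag tau] between [tc] and the
    exit time, the curve is [zc - k0 * speed (s t) * (t - s t)]. *)
Lemma shock_in_simple_wave (k0 k1 zc z0 : R) : 0 < k1 < k0 -> 0 < zc -> zc < z0 ->
  exists G : R -> R,
    (forall t, continuous G t) /\
    G (t0 k0 k1 zc z0) = 0 /\
    G (exit_time k1 zc z0) = zc /\
    (forall t, t0 k0 k1 zc z0 <= t < exit_time k1 zc z0 -> G t < zc) /\
    (forall t, t0 k0 k1 zc z0 < t < exit_time k1 zc z0 ->
       exists tau,
         on_characteristic k0 k1 zc z0 (trace (k1 / k0) (tc k1 zc z0)) tau (G t) t /\
         is_derive G t (k0 * trace (k1 / k0) (tc k1 zc z0) tau)).
Proof.
  intros hk hzc hz.
  assert (hr := shear_ratio_bounds k0 k1 hk).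
  assert (hc : 0 < tc k1 zc z0) by (apply Rdiv_lt_0_compat; lra).
  assert (hlate := exit_time_late k0 k1 zc z0 hk hzc hz).
  assert (hbal := exit_time_balance k1 zc z0 ltac:(lra) hzc hz).
  assert (ht0 : t0 k0 k1 zc z0 = tc k1 zc z0 + 4 * zc / k0 / 4)
    by (unfold t0; field; lra).
  set (r := k1 / k0) in *; set (c := tc k1 zc z0) in *.
  set (b := exit_time k1 zc z0) in *; set (d := 4 * zc / k0) in *.
  assert (e : r * (b - c) ^ 2 = d * b).
  { unfold r, d; apply (Rmult_eq_reg_l k0); [|lra].
    transitivity (k1 * (b - c) ^ 2); [field; lra|]; rewrite hbal; field; lra. }
  assert (hm : 0 < sqrt (1 - r)) by (apply sqrt_lt_R0; lra).
  assert (hlag : forall x, c <= x <= b -> 0 <= lag r c d x).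
  { intros x hx; destruct (Req_dec x b) as [->|hne].
    - rewrite (lag_final r c d b); [lra | lra | exact e].
    - apply Rlt_le, (lag_pos r c d b); try assumption; lra. }
  destruct (inverse_function (fun x => x + lag r c d x) (arrival_rate r c d) c b
              (sqrt (1 - r))) as (s & hs & hret & hinv & hcont & hder); try assumption.
  - lra.
  - intros x hx; apply is_derive_arrival; lra.
  - intros x hx; assert (hb := speed_bounds r c x hr hc ltac:(lra)).
    assert (hl := hlag x hx); unfold arrival_rate.
    assert (0 <= lag r c d x * (r * c ^ 2 / (x ^ 3 * speed r c x))).
    { apply Rmult_le_pos; [exact hl|]; apply Rlt_le, Rdiv_lt_0_compat.
      - apply Rmult_lt_0_compat; [lra | apply pow_lt, hc].
      - apply Rmult_lt_0_compat; [apply pow_lt |]; lra. }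
    apply Rmult_le_reg_r with (1 + speed r c x); [lra|].
    unfold Rdiv; rewrite (Rmult_assoc _ (/ _)), Rinv_l by lra. nra.
  - rewrite lag_initial in hinv, hder by exact hc.
    rewrite (lag_final r c d b ltac:(lra) e), Rplus_0_r in hinv, hder.
    rewrite <- ht0 in hinv, hder.
    set (G := fun t => zc - k0 * speed r c (s t) * (t - s t)).
    assert (hgap : forall t, t0 k0 k1 zc z0 <= t < b -> c <= s t < b).
    { intros t ht; assert (h := hs t); assert (hi := hinv t ltac:(lra)).
      destruct (Req_dec (s t) b) as [hb|]; [|lra].
      rewrite hb, (lag_final r c d b ltac:(lra) e) in hi; lra. }
    assert (hpos : forall t, t0 k0 k1 zc z0 <= t < b -> 0 < t - s t).
    { intros t ht; assert (hi := hinv t ltac:(lra)).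
      assert (hl := lag_pos r c d b (s t) hr hc (hgap t ht) e); lra. }
    assert (hstart : s (t0 k0 k1 zc z0) = c).
    { rewrite ht0.
      rewrite <- (lag_initial r c d hc); apply hret; lra. }
    assert (hend : s b = b).
    { rewrite <- (hret b) at 2 by lra.
      rewrite (lag_final r c d b ltac:(lra) e), Rplus_0_r; reflexivity. }
    assert (hspeed : forall x, c <= x -> ex_derive (speed r c) x).
    { intros x hx; eexists; apply is_derive_speed; assumption. }
    exists G; repeat split.
    + intros t; unfold G.
      apply (continuous_minus (V := R_NormedModule)); [apply continuous_const|].
      apply (continuous_mult (K := R_AbsRing) (fun t => k0 * speed r c (s t))).
      * apply (continuous_comp s (fun x => k0 * speed r c x)); [apply hcont|].
        apply (continuous_scal_r (V := R_NormedModule)).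
        apply (ex_derive_continuous (V := R_NormedModule)), hspeed, hs.
      * apply (continuous_minus (V := R_NormedModule)); [apply continuous_id | apply hcont].
    + unfold G; rewrite hstart, speed_initial by exact hc.
      rewrite ht0; unfold d; field; lra.
    + unfold G; rewrite hend; ring.
    + intros t ht; unfold G; assert (h := hpos t ht).
      assert (hb := speed_bounds r c (s t) hr hc (proj1 (hs t))).
      assert (0 < k0 * speed r c (s t)) by nra; nra.
    + intros t ht; exists (s t).
      assert (h := hpos t ltac:(lra)); assert (hst := hs t).
      split; [split; [exact (proj1 hst) | split; [lra|]]; unfold G, trace; field|].
      assert (hb := speed_bounds r c (s t) hr hc (proj1 hst)).
      assert (hd := hder t ht).
      assert (hsp := is_derive_speed r c (s t) hr hc (proj1 hst)).
      assert (hx : t = s t + lag r c d (s t)) by (symmetry; apply hinv; lra).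
      assert (ex_derive s t) by (eexists; exact hd).
      assert (hes := hspeed (s t) (proj1 hst)).
      unfold G; auto_derive; [auto|].
      replace (Derive (fun x => s x) t) with (/ arrival_rate r c d (s t))
        by (symmetry; apply is_derive_unique, hd).
      replace (Derive (fun x => speed r c x) (s t))
        with (- (r * c ^ 2 / (s t ^ 3 * speed r c (s t))))
        by (symmetry; apply is_derive_unique, hsp).
      replace (t + - s t) with (lag r c d (s t)) by lra.
      unfold arrival_rate, trace.
      assert (hl := hlag (s t) hst).
      set (u := lag r c d (s t)) in *; set (p := speed r c (s t)) in *.
      assert (hw : 0 <= u * (r * c ^ 2 / (s t ^ 3 * p))).
      { apply Rmult_le_pos; [exact hl|]; apply Rlt_le, Rdiv_lt_0_compat.
        - apply Rmult_lt_0_compat; [lra | apply pow_lt, hc].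
        - apply Rmult_lt_0_compat; [apply pow_lt |]; lra. }
      set (w := r * c ^ 2 / (s t ^ 3 * p)) in *.
      field; lra.
Qed.

(** The curve inside the simple wave and the parabola above the interface are
    glued at the exit time, where both equal [zc]. *)
Lemma lower_shock_exists (k0 k1 zc z0 : R) : 0 < k1 < k0 -> 0 < zc -> zc < z0 ->
  exists (phim : R -> R) (Phi : R -> R -> R) (g : R -> R),
    is_lower_trace k0 k1 zc z0 phim /\
    is_simple_wave k0 k1 zc z0 phim Phi /\
    is_lower_shock k0 k1 zc z0 phim Phi g.
Proof.
  intros hk hzc hz.
  assert (hr := shear_ratio_bounds k0 k1 hk).
  assert (hc : 0 < tc k1 zc z0) by (apply Rdiv_lt_0_compat; lra).
  assert (hlate := exit_time_late k0 k1 zc z0 hk hzc hz).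
  assert (hexit := lower_curve_exit k1 zc z0 ltac:(lra) hzc).
  destruct (shock_in_simple_wave k0 k1 zc z0 hk hzc hz)
    as (G & cG & G0 & Gb & Glt & Gd).
  set (phim := trace (k1 / k0) (tc k1 zc z0)) in *.
  set (b := exit_time k1 zc z0) in *.
  (* All characteristics through a point carry the same value, so the choice
     among them is immaterial. *)
  set (Phi := fun z t => phim (epsilon (inhabits 0)
                (fun tau => on_characteristic k0 k1 zc z0 phim tau z t))).
  assert (hPhi : is_simple_wave k0 k1 zc z0 phim Phi).
  { intros tau z t h.
    assert (h' := epsilon_spec (inhabits 0)
      (fun tau => on_characteristic k0 k1 zc z0 phim tau z t) (ex_intro _ tau h)).
    assert (hl := simple_wave_lipschitz _ _ _ _ _ _ _ _ _ hr hc ltac:(lra) h' h).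
    rewrite Rminus_diag, Rabs_R0, Rmult_0_r in hl.
    apply Rminus_diag_uniq; apply Rabs_eq_0.
    apply Rle_antisym; [|apply Rabs_pos].
    apply (Rmult_le_reg_l k0); [lra|]; rewrite Rmult_0_r; exact hl. }
  (* Clamping the two arguments makes the glued curve a sum of continuous
     functions, with no case distinction at the junction. *)
  set (g := fun t => G (Rmin b t) + (lower_curve k1 z0 (Rmax b t) - zc)).
  assert (gl : forall t, t <= b -> g t = G t).
  { intros t ht; unfold g; rewrite Rmin_right, Rmax_left by lra; lra. }
  assert (gr : forall t, b <= t -> g t = lower_curve k1 z0 t).
  { intros t ht; unfold g; rewrite Rmin_left, Rmax_right by lra; lra. }
  assert (hfirst : interface_time k0 k1 zc z0 g b).
  { split; [lra|]; split; [rewrite gl; lra|].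
    intros s hs; rewrite gl by lra; generalize (Glt s hs); lra. }
  exists phim, Phi, g; split; [|split; [exact hPhi|]].
  { apply trace_is_lower_trace; assumption. }
  split; [rewrite gl; lra|]; split; [|split].
  - apply continuous_on_forall; intros t _; unfold g.
    apply (continuous_plus (V := R_NormedModule)).
    + apply (continuous_comp (Rmin b) G); [apply continuous_Rmin | apply cG].
    + apply (continuous_minus (V := R_NormedModule)); [|apply continuous_const].
      apply (continuous_comp (Rmax b) (lower_curve k1 z0));
        [apply continuous_Rmax | apply continuous_lower_curve].
  - intros t ht hno.
    assert (htb : t < b).
    { apply Rnot_le_lt; intros h; apply (hno b); [lra|]; rewrite gl; lra. }
    destruct (Gd t ltac:(lra)) as (tau & hon & hd).
    rewrite gl by lra; split; [exists tau; exact hon|].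
    rewrite (hPhi tau _ _ hon).
    apply is_derive_ext_loc with (2 := hd).
    apply filter_imp with (2 := locally_lt b t htb).
    intros s hs; rewrite gl; lra.
  - intros that hthat t ht.
    rewrite (first_time_unique _ _ _ _ hthat hfirst) in ht.
    rewrite gr by lra.
    apply is_derive_ext_loc with (lower_curve k1 z0).
    + apply filter_imp with (2 := locally_gt b t ht).
      intros s hs; rewrite gr; lra.
    + apply is_derive_lower_curve; lra.
Qed.

(** A lower shock follows the curve of [shock_in_simple_wave] as long as it has
    not met [zc].  If it met [zc] before the exit time, then at the first such
    time both curves would agree, but the explicit one is still below [zc]. *)
Lemma lower_shock_shape (k0 k1 zc z0 : R) (phim : R -> R) (Phi : R -> R -> R) (g : R -> R) :
  0 < k1 < k0 -> 0 < zc -> zc < z0 ->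
  is_lower_trace k0 k1 zc z0 phim ->
  is_simple_wave k0 k1 zc z0 phim Phi ->
  is_lower_shock k0 k1 zc z0 phim Phi g ->
  interface_time k0 k1 zc z0 g (exit_time k1 zc z0) /\
  (forall t, t0 k0 k1 zc z0 <= t < exit_time k1 zc z0 -> g t < zc) /\
  (forall t, exit_time k1 zc z0 <= t -> g t = lower_curve k1 z0 t).
Proof.
  intros hk hzc hz htr hPhi (g0 & cg & dg1 & dg2).
  assert (hr := shear_ratio_bounds k0 k1 hk).
  assert (hc : 0 < tc k1 zc z0) by (apply Rdiv_lt_0_compat; lra).
  assert (hlate := exit_time_late k0 k1 zc z0 hk hzc hz).
  assert (hexit := lower_curve_exit k1 zc z0 ltac:(lra) hzc).
  destruct (shock_in_simple_wave k0 k1 zc z0 hk hzc hz)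
    as (G & cG & G0 & Gb & Glt & Gd).
  assert (hon' : forall tau z t, on_characteristic k0 k1 zc z0 phim tau z t ->
    phim tau = trace (k1 / k0) (tc k1 zc z0) tau /\
    on_characteristic k0 k1 zc z0 (trace (k1 / k0) (tc k1 zc z0)) tau z t).
  { intros tau z t (h1 & h2 & h3).
    assert (hp : phim tau = trace (k1 / k0) (tc k1 zc z0) tau).
    { apply (lower_trace_unique k0 k1 zc z0); try assumption; [lra|].
      apply trace_is_lower_trace; assumption. }
    rewrite hp in h3; split; [exact hp | split; [exact h1 | split; [exact h2 | exact h3]]]. }
  set (b := exit_time k1 zc z0) in *.
  assert (agree : forall x, x <= b ->
    (forall s, t0 k0 k1 zc z0 <= s < x -> g s <> zc) ->
    forall t, t0 k0 k1 zc z0 <= t <= x -> g t = G t).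
  { intros x hx hno.
    apply (ode_unique g G (fun t => k0 * Phi (g t) t) (Derive G) _ _
             (/ (2 * tc k1 zc z0 * sqrt (1 - k1 / k0) ^ 2))).
    - exact cg.
    - apply continuous_on_forall; intros t _; apply cG.
    - lra.
    - intros t ht; apply dg1; [lra|]; intros s hs; apply hno; lra.
    - intros t ht; destruct (Gd t ltac:(lra)) as (tau & _ & hd).
      apply Derive_correct; eexists; exact hd.
    - intros t ht; destruct (Gd t ltac:(lra)) as (tau & hon & hd).
      destruct (dg1 t ltac:(lra)) as [[tau' hon2] _].
      { intros s hs; apply hno; lra. }
      rewrite (hPhi _ _ _ hon2); destruct (hon' _ _ _ hon2) as [-> hon3].
      replace (Derive G t) with (k0 * trace (k1 / k0) (tc k1 zc z0) tau)
        by (symmetry; apply is_derive_unique, hd).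
      rewrite <- Rmult_minus_distr_l, Rabs_mult, (Rabs_right k0) by lra.
      apply (simple_wave_lipschitz k0 k1 zc z0 tau' tau (g t) (G t) t);
        try assumption; lra. }
  assert (hno : forall s, t0 k0 k1 zc z0 <= s < b -> g s <> zc).
  { intros s hs hsc.
    destruct (first_hit g _ s zc cg ltac:(lra) hsc) as (t & hts & hta & htc & htn).
    assert (h := agree t ltac:(lra) htn t ltac:(lra)).
    assert (hlt := Glt t ltac:(lra)); lra. }
  assert (hfirst : interface_time k0 k1 zc z0 g b).
  { split; [lra|]; split; [|exact hno].
    rewrite (agree b) by (try assumption; lra); exact Gb. }
  split; [exact hfirst|]; split.
  - intros t ht; rewrite (agree b) by (try assumption; lra); apply Glt, ht.
  - apply (rarefaction_ode_unique k1 z0 0).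
    + lra.
    + lra.
    + apply continuous_on_subset with (2 := cg); intros x hx; lra.
    + apply continuous_on_forall; intros t _; apply continuous_lower_curve.
    + rewrite hexit; apply hfirst.
    + intros t ht; rewrite Rminus_0_r; apply (dg2 b hfirst t ht).
    + intros t ht; rewrite Rminus_0_r; apply is_derive_lower_curve; lra.
Qed.

(** * Meeting of the two shocks *)

Lemma curves_gap (k1 z0 t : R) : 0 < z0 < 1 ->
  upper_curve k1 z0 t - lower_curve k1 z0 t
    = 2 * sqrt (k1 * t) * (sqrt z0 + sqrt (1 - z0) - sqrt (k1 * t)).
Proof.
  intros hz; unfold upper_curve, lower_curve.
  assert (e0 := pow2_sqrt z0 ltac:(lra)); assert (e1 := pow2_sqrt (1 - z0) ltac:(lra)).
  nra.
Qed.

Lemma sqrt_time_lt (k1 s t : R) : 0 < k1 -> 0 <= s < t ->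
  sqrt (k1 * s) < sqrt (k1 * t).
Proof. intros hk h; apply sqrt_lt_1_alt; nra. Qed.

(** Here [zc < 1 - z0] enters: it keeps the distance of [sqrt (k1 * t)] from
    [sqrt (1 - z0)] below [sqrt z0], so the upper shock stays above [1 - z0] until
    the lower one has left the simple wave. *)
Lemma upper_curve_above_interface (k1 zc z0 t : R) :
  0 < k1 -> 0 < zc -> zc < z0 -> z0 < 1 -> zc < 1 - z0 ->
  t1 k1 z0 <= t <= exit_time k1 zc z0 -> zc < upper_curve k1 z0 t.
Proof.
  intros hk hzc hz hz1 hzc' [h1 h2].
  assert (ht1 : 0 < t1 k1 z0) by (apply Rdiv_lt_0_compat; lra).
  assert (l1 : sqrt (1 - z0) <= sqrt (k1 * t)).
  { apply sqrt_le_1_alt; replace (1 - z0) with (k1 * t1 k1 z0) by (unfold t1; field; lra); nra. }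
  assert (l2 : sqrt (k1 * t) <= sqrt z0 + sqrt zc).
  { rewrite <- (sqrt_exit_time k1 zc z0 hk); apply sqrt_le_1_alt; nra. }
  assert (l3 : sqrt zc < sqrt (1 - z0)) by (apply sqrt_lt_1_alt; lra).
  assert (e0 := pow2_sqrt z0 ltac:(lra)).
  unfold upper_curve; set (x := sqrt (k1 * t)) in *.
  assert ((x - sqrt (1 - z0)) ^ 2 < sqrt z0 ^ 2); [|lra].
  assert (h0 := sqrt_pos z0); nra.
Qed.

(** Before the exit time the interface separates the two curves; afterwards their
    distance is [curves_gap], which first vanishes at the final time. *)
Lemma meeting_at_final_time (k0 k1 zc z0 : R) (g0 g1 : R -> R) :
  0 < k1 < k0 -> 0 < zc -> zc < z0 -> z0 < 1 -> zc < 1 - z0 ->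
  (forall t, t1 k1 z0 <= t -> g1 t = upper_curve k1 z0 t) ->
  (forall t, t0 k0 k1 zc z0 <= t < exit_time k1 zc z0 -> g0 t < zc) ->
  (forall t, exit_time k1 zc z0 <= t -> g0 t = lower_curve k1 z0 t) ->
  meeting_time k0 k1 zc z0 g0 g1 (final_time k1 z0) /\
  g0 (final_time k1 z0) = 1 - z0 /\ g1 (final_time k1 z0) = 1 - z0.
Proof.
  intros hk hzc hz hz1 hzc' h1 hbelow h0.
  assert (hlate := exit_time_late k0 k1 zc z0 hk hzc hz).
  assert (ht1 : 0 < t1 k1 z0) by (apply Rdiv_lt_0_compat; lra).
  assert (hsf := sqrt_final_time k1 z0 ltac:(lra) ltac:(lra)).
  assert (hse := sqrt_exit_time k1 zc z0 ltac:(lra)).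
  assert (l3 : sqrt zc < sqrt (1 - z0)) by (apply sqrt_lt_1_alt; lra).
  assert (p0 : 0 < sqrt z0) by (apply sqrt_lt_R0; lra).
  assert (pc : 0 < sqrt zc) by (apply sqrt_lt_R0; lra).
  assert (e1 := pow2_sqrt (1 - z0) ltac:(lra)).
  assert (e0 := pow2_sqrt z0 ltac:(lra)).
  assert (hpos : 0 <= final_time k1 z0).
  { unfold final_time; apply Rmult_le_pos; [apply Rlt_le, Rdiv_lt_0_compat; lra|].
    generalize (sqrt_pos (z0 * (1 - z0))); lra. }
  assert (hef : exit_time k1 zc z0 < final_time k1 z0).
  { apply Rnot_le_lt; intros h.
    assert (sqrt (k1 * final_time k1 z0) <= sqrt (k1 * exit_time k1 zc z0))
      by (apply sqrt_le_1_alt; nra).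
    lra. }
  assert (htf : t1 k1 z0 < final_time k1 z0).
  { apply Rnot_le_lt; intros h.
    assert (sqrt (k1 * final_time k1 z0) <= sqrt (k1 * t1 k1 z0))
      by (apply sqrt_le_1_alt; nra).
    replace (k1 * t1 k1 z0) with (1 - z0) in H by (unfold t1; field; lra).
    lra. }
  assert (v0 : g0 (final_time k1 z0) = 1 - z0).
  { rewrite h0 by lra; unfold lower_curve; rewrite hsf.
    replace (sqrt z0 + sqrt (1 - z0) - sqrt z0) with (sqrt (1 - z0)) by ring; exact e1. }
  assert (v1 : g1 (final_time k1 z0) = 1 - z0).
  { rewrite h1 by lra; unfold upper_curve; rewrite hsf.
    replace (sqrt z0 + sqrt (1 - z0) - sqrt (1 - z0)) with (sqrt z0) by ring; lra. }
  split; [|split; assumption].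
  split; [apply Rmax_lub; lra|]; split; [rewrite v0, v1; reflexivity|].
  intros s [hs1 hs2].
  assert (s0 := Rle_trans _ _ _ (Rmax_l _ _) hs1).
  assert (s1 := Rle_trans _ _ _ (Rmax_r _ _) hs1).
  rewrite (h1 s s1).
  destruct (Rlt_dec s (exit_time k1 zc z0)) as [h|h].
  - assert (hb := hbelow s (conj s0 h)).
    assert (ha := upper_curve_above_interface k1 zc z0 s ltac:(lra) hzc hz hz1 hzc' ltac:(lra)).
    lra.
  - rewrite (h0 s ltac:(lra)).
    assert (hgap := curves_gap k1 z0 s ltac:(lra)).
    assert (hlt := sqrt_time_lt k1 s (final_time k1 z0) ltac:(lra) ltac:(lra)).
    assert (hsp : 0 < sqrt (k1 * s)) by (apply sqrt_lt_R0; nra).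
    nra.
Qed.

Theorem mainTheorem1 (k1 zc z0 : R)
    (hzc : 0 < zc) (hzcz0 : zc < z0) (hz0 : z0 < 1) (hzc' : zc < 1 - z0)
    (hk1 : 0 < k1) :
  (forall k0 : R, k1 < k0 ->
     (exists g0 g1 : R -> R, shock_curves k0 k1 zc z0 g0 g1) /\
     (forall g0 g1 : R -> R, shock_curves k0 k1 zc z0 g0 g1 ->
        (exists that : R,
           interface_time k0 k1 zc z0 g0 that /\
           that = 1 / k1 * (sqrt z0 + sqrt zc) ^ 2) /\
        (exists tstar : R,
           meeting_time k0 k1 zc z0 g0 g1 tstar /\
           tstar = 1 / k1 * (1 + 2 * sqrt (z0 * (1 - z0))) /\
           g0 tstar = 1 - z0 /\ g1 tstar = 1 - z0))) /\
  (forall (k0 k0' : R) (g0 g1 g0' g1' : R -> R) (that that' tstar tstar' : R),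
     k1 < k0 -> k1 < k0' ->
     shock_curves k0 k1 zc z0 g0 g1 -> shock_curves k0' k1 zc z0 g0' g1' ->
     interface_time k0 k1 zc z0 g0 that ->
     interface_time k0' k1 zc z0 g0' that' ->
     meeting_time k0 k1 zc z0 g0 g1 tstar ->
     meeting_time k0' k1 zc z0 g0' g1' tstar' ->
     that = that' /\ tstar = tstar').
Proof.
  assert (times : forall k0 g0 g1, k1 < k0 -> shock_curves k0 k1 zc z0 g0 g1 ->
    interface_time k0 k1 zc z0 g0 (exit_time k1 zc z0) /\
    meeting_time k0 k1 zc z0 g0 g1 (final_time k1 z0) /\
    g0 (final_time k1 z0) = 1 - z0 /\ g1 (final_time k1 z0) = 1 - z0).
  { intros k0 g0 g1 hk [hup (phim & Phi & htr & hPhi & hlow)].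
    destruct (lower_shock_shape k0 k1 zc z0 phim Phi g0) as (hexit & hbelow & hafter);
      try assumption; [lra|].
    split; [exact hexit|].
    apply (meeting_at_final_time k0 k1 zc z0); try assumption; [lra|].
    apply upper_shock_unique; assumption. }
  split.
  - intros k0 hk; split.
    + destruct (lower_shock_exists k0 k1 zc z0) as (phim & Phi & g0 & h); try lra.
      exists g0, (upper_curve k1 z0); split.
      * apply upper_shock_exists; assumption.
      * exists phim, Phi; exact h.
    + intros g0 g1 h; destruct (times k0 g0 g1 hk h) as (hexit & hmeet & hvals).
      split.
      * exists (exit_time k1 zc z0); split; [exact hexit | reflexivity].
      * exists (final_time k1 z0); split; [exact hmeet | split; [reflexivity | exact hvals]].
  - intros k0 k0' g0 g1 g0' g1' that that' tstar tstar' hk hk' hs hs' hi hi' hm hm'.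
    destruct (times k0 g0 g1 hk hs) as (hexit & hmeet & _).
    destruct (times k0' g0' g1' hk' hs') as (hexit' & hmeet' & _).
    rewrite (first_time_unique _ _ _ _ hi hexit), (first_time_unique _ _ _ _ hi' hexit').
    rewrite (first_time_unique _ _ _ _ hm hmeet), (first_time_unique _ _ _ _ hm' hmeet').
    split; reflexivity.
Qed.
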